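(* Let $L$ be a multiplicative lattice, let $H\subseteq L$ be a wire of $L$, and let $r:\mathcal{P}(H)\rightarrow\mathcal{P}(H)$ be the weak ideal system on $H$ given by $X_r=H\cap[0,\bigvee X]$ for $X\subseteq H$ (where $\bigvee X$ is computed in $L$). Then: (i) $r$ is an ideal system if and only if $H$ is an M-wire. (ii) $r$ is finitary if and only if $H$ consists of compact elements of $L$.
   Context: A multiplicative lattice is a complete lattice $L$ with least element $0$ and greatest element $1$, equipped with a commutative monoid operation with identity $1$ that is completely join distributive: $x\cdot\bigvee A=\bigvee_{a\in A}xa$ for all $x\in L$, $A\subseteq L$. For $a,b\in L$, $[a,b]=\{x\in L\mid a\le x\le b\}$. An element $x\in L$ is compact if $x\le\bigvee A$ with $A\subseteq L$ implies $x\le\bigvee B$ for some finite subset $B$ of $A$. A monoid means a commutative monoid with identity $1$ and zero element $0$ (so $0x=0$ for all $x$); a submonoid of $L$ is a multiplicatively closed subset containing $1$ and $0$. A subset $C\subseteq L$ generates $L$ (as a lattice) if every element of $L$ is a join of some (possibly infinitely many, possibly no) elements of $C$. A wire of $L$ is a submonoid $H$ of $L$ which generates $L$ as a lattice. A wire $H$ is an M-wire if: whenever $s\le ta$ with $s,t\in H$ and $a\in L$, then $s=tu$ for some $u\in H\cap[0,a]$. Let $H$ be a monoid, $\mathcal{P}(H)$ its power set. A weak ideal system on $H$ is a map $r:\mathcal{P}(H)\to\mathcal{P}(H)$, $X\mapsto X_r$, such that: (s1) $XH\subseteq X_r$ for all $X\subseteq H$; (s2) $X\subseteq Y\subseteq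 H$ implies $X_r\subseteq Y_r$; (s3) $(X_r)_r=X_r$ for all $X\subseteq H$; (s4) $cX_r\subseteq(cX)_r$ for all $X\subseteq H$, $c\in H$. It is called an ideal system if equality always holds in (s4). It is called finitary if $X_r=\bigcup\{Z_r\mid Z\text{ a finite subset of }X\}$ for all $X\subseteq H$. *)

(* Defs.v *)
From HB Require Import structures.
From mathcomp Require Import all_boot all_order.
From mathcomp Require Import boolp classical_sets cardinality.

Set Implicit Arguments.
Unset Strict Implicit.
Unset Printing Implicit Defensive.

Import Order.TTheory.

Local Open Scope group_scope.
Local Open Scope order_scope.
Local Open Scope classical_set_scope.

HB.mixin Record Monoid_isCommutative M of Monoid M := {
  mulmC : commutative (@mul M)
}.

#[short(type="comMonoidType")]
HB.structure Definition ComMonoid := {M of Monoid M & Monoid_isCommutative M}.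

HB.mixin Record ComMonoid_hasZero M of ComMonoid M := {
  zerom : M;
  mul0m : left_zero zerom (@mul M)
}.

#[short(type="zeroComMonoidType")]
HB.structure Definition ZeroComMonoid :=
  {M of ComMonoid M & ComMonoid_hasZero M}.

HB.mixin Record TBLattice_isComplete d L of Order.TBLattice d L := {
  supremums_neq0 : forall A : set L, supremums A !=set0;
  infimums_neq0 : forall A : set L, infimums A !=set0
}.

#[short(type="completeLatticeType")]
HB.structure Definition CompleteLattice d :=
  {L of Order.TBLattice d L & TBLattice_isComplete d L}.

(* The default value \bot of [supremum] is only returned for the empty set,
   whose join it is. *)
Definition bigjoin d (L : completeLatticeType d) (A : set L) : L :=
  supremum \bot A.

(* The case A = set0 of [mul_bigjoin] says that \bot is absorbing. *)
HB.mixin Record isMultLattice d L of CompleteLattice d L & ComMonoid L := {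
  one_top : (1 : L) = \top;
  mul_bigjoin : forall (x : L) (A : set L),
    x * bigjoin A = bigjoin [set x * a | a in A]
}.

#[short(type="multLatticeType")]
HB.structure Definition MultLattice d :=
  {L of CompleteLattice d L & ComMonoid L & isMultLattice d L}.

Section CompleteLatticeTheory.
Context d (L : completeLatticeType d).
Implicit Types (A B : set L) (x : L).

Lemma bigjoinP A : isLub A (bigjoin A).
Proof.
rewrite /bigjoin /supremum; case: ifPn => [/eqP->|_].
  by split=> // b _; exact: le0x.
by case: xgetP => [y _ [? ?]//|nA]; have [y /nA] := supremums_neq0 A.
Qed.

Lemma le_bigjoin A x : A x -> x <= bigjoin A.
Proof. by move=> Ax; apply: (bigjoinP A).1. Qed.

Lemma bigjoin_le A x : ubound A x -> bigjoin A <= x.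
Proof. exact: (bigjoinP A).2. Qed.

Lemma bigjoinS A B : A `<=` B -> bigjoin A <= bigjoin B.
Proof. by move=> AB; apply: bigjoin_le => x /AB /le_bigjoin. Qed.

Lemma bigjoin0 : bigjoin (set0 : set L) = \bot.
Proof. exact: supremum0. Qed.

Definition segment (a b : L) : set L := [set x | a <= x <= b].

Definition generates (C : set L) : Prop :=
  forall x : L, exists2 A : set L, A `<=` C & x = bigjoin A.

Definition compact_elt (x : L) : Prop :=
  forall A : set L, x <= bigjoin A ->
    exists B : set L, [/\ finite_set B, B `<=` A & x <= bigjoin B].

End CompleteLatticeTheory.

Section MultLatticeTheory.
Context d (L : multLatticeType d).
Implicit Types (H : set L) (x y z : L).

Lemma mulm_bot x : x * \bot = \bot.
Proof.
rewrite -[X in _ * X]bigjoin0 mul_bigjoin.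
by rewrite image_set0 bigjoin0.
Qed.

Lemma lem_mul2l x y z : y <= z -> x * y <= x * z.
Proof.
move=> yz; have -> : z = bigjoin [set y; z].
  apply/le_anti/andP; split; first by apply: le_bigjoin; right.
  by apply: bigjoin_le => _ [->|->].
by rewrite mul_bigjoin; apply: le_bigjoin; exists y => //; left.
Qed.

Lemma mulm_lel x y : x * y <= x.
Proof.
by rewrite -[X in _ <= X]mulg1; apply: lem_mul2l; rewrite one_top lex1.
Qed.

Record submonoid H : Prop := Submonoid {
  submonoid1 : H 1;
  submonoid0 : H \bot;
  submonoidM : forall x y, H x -> H y -> H (x * y)
}.

Record wire H : Prop := Wire {
  wire_submonoid : submonoid H;
  wire_generates : generates H
}.

Record M_wire H : Prop := MWire {
  M_wire_wire : wire H;
  M_wire_factor : forall s t a : L, H s -> H t -> s <= t * a ->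
    exists2 u : L, (H `&` segment \bot a) u & s = t * u
}.

End MultLatticeTheory.

(* A submonoid H of L as a type; the proof hH gives access to the inherited
   monoid structure. *)
Definition submonoid_type d (L : multLatticeType d) (H : set L)
  (hH : submonoid H) : Type := {x : L | x \in H}.

Section SubmonoidType.
Context d (L : multLatticeType d) (H : set L) (hH : submonoid H).
Local Notation S := (submonoid_type hH).

Let inH : pred L := fun x => x \in H.

Let submonoid_closed : monoid_closed inH.
Proof.
split; first by apply/mem_set; exact: submonoid1.
by move=> x y /set_mem Hx /set_mem Hy; apply/mem_set; exact: submonoidM.
Qed.

HB.instance Definition _ := [isSub of S for @proj1_sig L inH].
HB.instance Definition _ := [Choice of S by <:].
HB.instance Definition _ :=
  SubChoice_isSubMonoid.Build L inH S submonoid_closed.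

Let submonoid_mulC : commutative (@mul S).
Proof. by move=> x y; apply: val_inj; rewrite !gmulfM mulmC. Qed.

HB.instance Definition _ := Monoid_isCommutative.Build S submonoid_mulC.

Let submonoid_zero : S :=
  exist (fun x => x \in H) \bot (mem_set (submonoid0 hH)).

Let submonoid_mul0 : left_zero submonoid_zero (@mul S).
Proof. by move=> x; apply: val_inj; rewrite gmulfM /= mulmC mulm_bot. Qed.

HB.instance Definition _ := ComMonoid_hasZero.Build S submonoid_mul0.

End SubmonoidType.

Record weak_ideal_system (M : zeroComMonoidType) := WeakIdealSystem {
  wis_map :> set M -> set M;
  wis_mul : forall X, [set x * h | x in X & h in [set: M]] `<=` wis_map X;
  wis_mono : forall X Y, X `<=` Y -> wis_map X `<=` wis_map Y;
  wis_idem : forall X, wis_map (wis_map X) = wis_map X;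
  wis_trans : forall X c,
    [set c * x | x in wis_map X] `<=` wis_map [set c * x | x in X]
}.

Definition ideal_system (M : zeroComMonoidType) (r : weak_ideal_system M) :=
  forall X c, [set c * x | x in r X] = r [set c * x | x in X].

Definition finitary (M : zeroComMonoidType) (r : weak_ideal_system M) :=
  forall X, r X = \bigcup_(Z in [set Z | finite_set Z /\ Z `<=` X]) r Z.

Section LatticeSystem.
Context d (L : multLatticeType d) (H : set L) (hH : submonoid H).
Local Notation S := (submonoid_type hH).
Implicit Types (X Y : set S) (c : S).

(* H `&` [0, \/ X], as a subset of the type of H *)
Definition lattice_closure X : set S :=
  [set h | segment \bot (bigjoin [set val x | x in X]) (val h)].

Lemma lattice_closureE X h :
  lattice_closure X h = (val h <= bigjoin [set val x | x in X]) :> Prop.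
Proof. by rewrite /lattice_closure /segment /= le0x. Qed.

Lemma lattice_closure_mul X :
  [set x * h | x in X & h in [set: S]] `<=` lattice_closure X.
Proof.
move=> _ [x Xx [h _ <-]]; rewrite lattice_closureE gmulfM.
by apply: le_trans (mulm_lel _ _) _; apply: le_bigjoin; exists x.
Qed.

Lemma lattice_closure_mono X Y :
  X `<=` Y -> lattice_closure X `<=` lattice_closure Y.
Proof.
move=> XY h; rewrite !lattice_closureE => /le_trans; apply.
by apply: bigjoinS => _ [x /XY Yx <-]; exists x.
Qed.

Lemma lattice_closure_idem X :
  lattice_closure (lattice_closure X) = lattice_closure X.
Proof.
apply/seteqP; split=> h; rewrite !lattice_closureE => hX.
  apply: (le_trans hX); apply: bigjoin_le => _ [x Xx <-].
  by rewrite lattice_closureE in Xx.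
by apply: le_bigjoin; exists h => //; rewrite lattice_closureE.
Qed.

Lemma lattice_closure_trans X c :
  [set c * x | x in lattice_closure X] `<=`
    lattice_closure [set c * x | x in X].
Proof.
move=> _ [x + <-]; rewrite !lattice_closureE gmulfM => xX.
apply: (le_trans (lem_mul2l _ xX)); rewrite mul_bigjoin.
apply: bigjoin_le => _ [_ [y Xy <-] <-]; apply: le_bigjoin.
by exists (c * y); [exists y | rewrite gmulfM].
Qed.

Definition lattice_system : weak_ideal_system S :=
  WeakIdealSystem lattice_closure_mul lattice_closure_mono
    lattice_closure_idem lattice_closure_trans.

End LatticeSystem.

(* Main.v *)
Require Import Defs.
From HB Require Import structures.
From mathcomp Require Import all_boot all_order.
From mathcomp Require Import boolp classical_sets cardinality.

(** The closure [X_r] only remembers the element [\/ X] of [L], and this turns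
    both sides of each equivalence into a statement about joins in [L].

    For ideal systems, distributivity gives [\/ (cX) = c (\/ X)]
    (bigjoin_val_mull), so the inclusion of [(cX)_r] in [c X_r] says that every
    [h <= c (\/ X)] in [H] is of the form [c u] with [u <= \/ X] in [H]. This
    is the factorization property of an M-wire for [a = \/ X], and every [a] in
    [L] is such a join because [H] generates [L].

    For finitary systems, [X_r] being the union of the [Z_r] says that elements
    of [H] are compact with respect to joins of subsets of [H]. To pass to the
    join of an arbitrary subset [A] of [L], replace [A] by the set of elements
    of [H] lying below some member of [A]: this does not shrink the join because
    [H] generates [L] (generates_le_bigjoin_lower), and each of the finitely
    many elements of [H] that suffice can be enlarged to a member of [A]
    (bigjoin_finite_cofinal). *)

Set Implicit Arguments.
Unset Strict Implicit.
Unset Printing Implicit Defensive.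

Import Order.TTheory.

Local Open Scope group_scope.
Local Open Scope order_scope.
Local Open Scope classical_set_scope.

(** Each member of [A] is a join of elements of [C], all of which lie below it.
    So a join of arbitrary elements can be traded for a join of elements of
    [C]. *)
Lemma generates_le_bigjoin_lower d (L : completeLatticeType d) (C A : set L) :
  generates C ->
  bigjoin A <= bigjoin [set h | C h /\ exists2 a, A a & h <= a].
Proof.
move=> genC; apply: bigjoin_le => a Aa; have [B BC aE] := genC a.
rewrite {1}aE; apply: bigjoinS => b Bb; split; first exact: BC.
by exists a => //; rewrite aE; exact: le_bigjoin.
Qed.

Lemma bigjoin_finite_cofinal d (L : completeLatticeType d) (Z A : set L) :
    finite_set Z -> (forall z, Z z -> exists2 a, A a & z <= a) ->
  exists B, [/\ finite_set B, B `<=` A & bigjoin Z <= bigjoin B].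
Proof.
move=> finZ ZA.
have /choice[f fP] : forall z, exists a, Z z -> A a /\ z <= a.
  move=> z; have [/ZA[a Aa za]|nZz] := pselect (Z z); first by exists a.
  by exists z.
exists (f @` Z); split; first exact: finite_image.
  by move=> _ [z /fP[Afz _] <-].
apply: bigjoin_le => z Zz; apply: le_trans (fP z Zz).2 _.
by apply: le_bigjoin; exists z.
Qed.

Section LatticeSystemTheory.
Context d (L : multLatticeType d) (H : set L) (hH : submonoid H).
Local Notation S := (submonoid_type hH).
Implicit Types (X : set S) (c : S).

Lemma submonoid_valP (h : S) : H (val h).
Proof. exact: set_mem (valP h). Qed.

Lemma submonoid_val_ex (x : L) : H x -> exists h : S, val h = x.
Proof. by move=> /mem_set Hx; exists (exist _ x Hx). Qed.

Lemma image_val_preimage (A : set L) :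
  A `<=` H -> [set val h | h in [set h : S | A (val h)]] = A.
Proof.
move=> AH; apply/seteqP; split=> [_ [h Ah <-] //|a Aa].
by have [h ha] := submonoid_val_ex (AH _ Aa); exists h => //=; rewrite ha.
Qed.

(** Complete distributivity of [L], read in the submonoid: this is what makes
    the closure compatible with multiplication. *)
Lemma bigjoin_val_mull c X :
  bigjoin [set val y | y in [set c * x | x in X]] =
  val c * bigjoin [set val x | x in X].
Proof.
rewrite mul_bigjoin; congr bigjoin; apply/seteqP; split.
  by move=> _ [_ [x Xx <-] <-]; exists (val x); [exists x | rewrite gmulfM].
by move=> _ [_ [x Xx <-] <-]; exists (c * x); [exists x | rewrite gmulfM].
Qed.

(** Write [a = \/ X] with [X] inside [H]. Then [s <= t a = \/ (tX)] puts [s] in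
    the closure of [tX], which for an ideal system is [t] times the closure of
    [X]; the cofactor of [t] is the required [u]. *)
Lemma ideal_system_factor (s t a : L) :
    generates H -> ideal_system (lattice_system hH) ->
    H s -> H t -> s <= t * a ->
  exists2 u : L, (H `&` segment \bot a) u & s = t * u.
Proof.
move=> genH idr /submonoid_val_ex[{}s <-] /submonoid_val_ex[{}t <-].
have [A AH ->] := genH a; rewrite -(image_val_preimage AH).
set X := [set h : S | A (val h)].
rewrite -bigjoin_val_mull -lattice_closureE => sX.
have : lattice_system hH [set t * x | x in X] s by [].
rewrite -idr => -[u uX <-]; exists (val u); last by rewrite gmulfM.
by split; [exact: submonoid_valP | exact: uX].
Qed.

Lemma M_wire_ideal_system : M_wire H -> ideal_system (lattice_system hH).
Proof.
move=> [_ factor] X c; apply/seteqP; split; first exact: wis_trans.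
move=> h /=; rewrite lattice_closureE bigjoin_val_mull => hX.
have [_ [/submonoid_val_ex[u <-] uX] hE] :=
  factor _ _ _ (submonoid_valP h) (submonoid_valP c) hX.
by exists u => //; apply: val_inj; rewrite gmulfM hE.
Qed.

(** Finitarity only speaks of subsets of [H], whereas compactness quantifies over
    all subsets [A] of [L]; the set [D] of elements of [H] below some member of
    [A] bridges the two. *)
Lemma finitary_compact (x : L) :
  generates H -> finitary (lattice_system hH) -> H x -> compact_elt x.
Proof.
move=> genH finr /submonoid_val_ex[{}x <-] A xA.
set D := [set h | H h /\ exists2 a, A a & h <= a].
have DH : D `<=` H by move=> h [].
have xD : lattice_system hH [set h | D (val h)] x.
  rewrite /= lattice_closureE image_val_preimage //.
  exact: le_trans xA (generates_le_bigjoin_lower _ genH).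
move: xD; rewrite finr => -[Z [finZ ZD]] /=; rewrite lattice_closureE => xZ.
have [|B [finB BA ZB]] :=
  @bigjoin_finite_cofinal _ _ _ A (finite_image val finZ).
  by move=> _ [z /ZD[_ za] <-].
by exists B; split=> //; exact: le_trans xZ ZB.
Qed.

Lemma compact_finitary :
  (forall x : L, H x -> compact_elt x) -> finitary (lattice_system hH).
Proof.
move=> cpt X; apply/seteqP; split; last first.
  by move=> h [Z [_ ZX]]; exact: wis_mono.
move=> h /=; rewrite lattice_closureE => /(cpt _ (submonoid_valP h)).
move=> [B [finB BX hB]].
have BH : B `<=` H by move=> _ /BX[x _ <-]; exact: submonoid_valP.
exists [set z | B (val z)] => /=; last first.
  by rewrite lattice_closureE image_val_preimage.
split; first by apply: finite_preimage => // ? ? _ _; exact: val_inj.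
by move=> z /BX[x Xx /val_inj <-].
Qed.

End LatticeSystemTheory.

Theorem corollary5 (d : Order.disp_t) (L : multLatticeType d) (H : set L)
    (wH : wire H) :
  let r := lattice_system (wire_submonoid wH) in
  (ideal_system r <-> M_wire H) /\
  (finitary r <-> (forall x : L, H x -> compact_elt x)).
Proof.
have genH := wire_generates wH; move=> r; split; split.
- by move=> idr; split=> // s t a; exact: ideal_system_factor genH idr.
- exact: M_wire_ideal_system.
- by move=> finr x; exact: finitary_compact genH finr.
- exact: compact_finitary.
Qed.
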